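(* There is an absolute constant $C>0$ such that for every prime $p\geq 3$ and every function $f:\mathbb{Z}/p\mathbb{Z}\to\mathbb{R}$ with $\mathbb{E} f=0$ and $\Vert\widehat{f}\Vert_1\leq 1$ one has \[ \min_{x\in\mathbb{Z}/p\mathbb{Z}} |f(x)| \;\leq\; C\left(\frac{\log\log p}{\log p}\right)^{1/3}. \]
   Context: For $f:\mathbb{Z}/p\mathbb{Z}\to\mathbb{R}$: $\mathbb{E} f:=\frac1p\sum_{x\in\mathbb{Z}/p\mathbb{Z}} f(x)$; the Fourier transform is $\widehat{f}(r):=\frac1p\sum_{x\in\mathbb{Z}/p\mathbb{Z}} f(x)e^{2\pi i rx/p}$ for $r\in\mathbb{Z}/p\mathbb{Z}$; and $\Vert\widehat{f}\Vert_1:=\sum_{r\in\mathbb{Z}/p\mathbb{Z}}|\widehat{f}(r)|$ (unnormalised sum). *)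

(* Defs.v *)
From mathcomp Require Import all_boot all_order all_algebra.
From mathcomp Require Import complex.
From mathcomp Require Import all_classical all_reals all_analysis.

Set Implicit Arguments.
Unset Strict Implicit.
Unset Printing Implicit Defensive.

Import Order.TTheory GRing.Theory Num.Theory.

Local Open Scope ring_scope.
Local Open Scope complex_scope.

(* ['F_p] is Z/pZ when [p] is prime; the definitions below are meant for
   prime [p] only, since for other values ['F_p] has [pdiv p] elements. *)

Definition mean (R : realType) (p : nat) (f : 'F_p -> R) : R :=
  p%:R^-1 * \sum_(x : 'F_p) f x.

Definition expi (R : realType) (t : R) : R[i] := cos t +i* sin t.

(* [r] and [x] are replaced by their representatives in {0, ..., p-1}; by
   2pi-periodicity the value depends only on the class of [r * x]. *)
Definition fourier (R : realType) (p : nat) (f : 'F_p -> R) (r : 'F_p) : R[i] :=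
  p%:R^-1 * \sum_(x : 'F_p)
    (f x)%:C * expi (2 * pi * (r * x)%N%:R / p%:R).

Definition fourier_l1 (R : realType) (p : nat) (f : 'F_p -> R) : R :=
  \sum_(r : 'F_p) ComplexField.Normc.normc (fourier f r).

(* The default value [`|f 0|] of the iterated minimum is itself one of the
   values, so this is the minimum over all of ['F_p]. *)
Definition min_abs (R : realType) (p : nat) (f : 'F_p -> R) : R :=
  \big[Num.min/`|f 0|]_(x : 'F_p) `|f x|.

(* Main.v *)
(* Write n(y) = |1 - e(y)| and, for a list S of frequencies, let beta be the Gibbs
   measure proportional to exp(-l sum_{s in S} n(sx)); it plays the role of a
   smoothed Bohr set. Since E f = 0, a Dirichlet translate and a discrete
   intermediate value argument give x with |E_beta f(x + .)| small. If |f| >= d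
   everywhere then f cannot be nearly constant in L^1(beta) around x, so the
   frequencies r that are not yet nearly trivial on beta carry Fourier mass; a
   second moment bound shows that mass >= d/4 of it lies in few clusters of
   size >= d^2/128 for the correlation |beta^(r - s)|. Adding the cluster centres
   to S and cooling l by a factor O(log p / d^3) makes these frequencies nearly
   trivial too. The total mass being at most 1, this stops after 4/d steps with
   at most 128/d^2 frequencies, and Dirichlet remains applicable throughout as
   soon as d^3 >> loglog p / log p. *)

Require Import Defs.
From mathcomp Require Import all_boot all_order all_algebra.
From mathcomp Require Import all_classical all_reals all_analysis.
From mathcomp Require Import complex ring lra zify fintype finset.

Set Implicit Arguments.
Unset Strict Implicit.
Unset Printing Implicit Defensive.

Import Order.TTheory GRing.Theory Num.Theory.
Import ComplexField.Normc.

Local Open Scope ring_scope.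

(** * Modulus of complex numbers and differences of exponentials *)

Section Modulus.
Context {R : realType}.
Implicit Types (z w : R[i]) (u v : R).

Lemma normc_ge0 z : 0 <= normc z.
Proof. by case: z => a b; rewrite /normc sqrtr_ge0. Qed.

Lemma normcB z w : normc (z - w) = normc (w - z).
Proof. by rewrite -opprB normcN. Qed.

Lemma ler_normc_sum (I : Type) (r : seq I) (P : pred I) (g : I -> R[i]) :
  normc (\sum_(i <- r | P i) g i) <= \sum_(i <- r | P i) normc (g i).
Proof.
elim/big_rec2: _ => [|i x y _ ih]; first by rewrite normc0.
by rewrite (le_trans (le_normcD _ _))// lerD2l.
Qed.

Lemma normc_real u : normc u%:C%C = `|u|.
Proof. by rewrite /= expr0n addr0 sqrtr_sqr. Qed.

Lemma sqr_normcE z : (normc z ^+ 2)%:C%C = z * z^*%C.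
Proof.
case: z => a b; rewrite /normc sqr_sqrtr ?addr_ge0 ?sqr_ge0//.
by simpc; rewrite !expr2 [b * a]mulrC addNr.
Qed.

Lemma normc_conj z : normc z^*%C = normc z.
Proof. by case: z => a b; rewrite /= sqrrN. Qed.

Lemma normc_leD u v : normc (u +i* v)%C <= `|u| + `|v|.
Proof.
rewrite /= -[X in _ <= X]ger0_norm ?addr_ge0//.
rewrite -sqrtr_sqr ler_wsqrtr// sqrrD !real_normK ?num_real//.
by rewrite -addrA lerD2l lerDr mulrn_wge0// mulr_ge0.
Qed.

(** For [v <= u] this follows from the tangent inequality [1 + (v - u) <= expR (v - u)]. The
    symmetric right-hand side can be summed over a measure and its translate alike. *)
Lemma norm_expRB u v : `|expR u - expR v| <= `|u - v| * (expR u + expR v).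
Proof.
wlog uv : u v / v <= u.
  move=> H; case: (leP v u) => [/H//|/ltW/H].
  by rewrite distrC [`|v - u|]distrC [expR v + _]addrC.
rewrite !ger0_norm ?subr_ge0 ?ler_expR//.
have := expR_ge1Dx (v - u); rewrite expRD expRN => h.
have h2 : (1 + (v - u)) * expR u <= expR v.
  by rewrite -ler_pdivlMr ?expR_gt0.
have : 0 <= (u - v) * expR v by rewrite mulr_ge0 ?subr_ge0// expR_ge0.
by nra.
Qed.

End Modulus.

(** * Greedy clustering and a discrete intermediate value theorem *)

Lemma big_disjoint_setU (R : realType) (T : finType) (m : T -> R) (A B : {set T}) :
  [disjoint A & B] ->
  \sum_(r in A :|: B) m r = \sum_(r in A) m r + \sum_(r in B) m r.
Proof.
by move=> dAB; rewrite -bigU//=; apply: eq_bigl => r; rewrite !inE.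
Qed.

(** While some [s] has related mass above [eps] in what is left of [U], that cluster is removed and
    [s] recorded. Each removal takes mass at least [eps], which bounds the number of centres, and a
    nonempty set, so the process stops. *)
Lemma greedy_clusters (R : realType) (T : finType) (m : T -> R) (E : rel T)
    (eps : R) (U : {set T}) : 0 < eps -> (forall r, 0 <= m r) ->
  exists (L : seq T) (C : {set T}),
  [/\ C \subset U,
      eps * (size L)%:R <= \sum_(r in C) m r,
      forall r, r \in C -> exists2 s, s \in L & E s r &
      forall s, \sum_(r in U :\: C | E s r) m r <= eps].
Proof.
move=> eps0 m0; have [n] := ubnP #|U|; elim: n U => // n IH U Un.
have [[s hs]|hU] :=
    pselect (exists s, eps < \sum_(r in U | E s r) m r); last first.
  exists [::], set0; split => [||r|s].
  - exact: sub0set.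
  - by rewrite mulr0 big_set0.
  - by rewrite in_set0.
  - by rewrite setD0 leNgt; apply/negP => hs; apply: hU; exists s.
set Q := [set r in U | E s r].
have QU : Q \subset U by apply/subsetP => r; rewrite inE => /andP[].
have sumQ : \sum_(r in Q) m r = \sum_(r in U | E s r) m r.
  by apply: eq_bigl => r; rewrite inE.
have Q0 : (0 < #|Q|)%N.
  rewrite lt0n cards_eq0; apply/eqP => Qe.
  by move: hs; rewrite -sumQ Qe big_set0 ltNge (ltW eps0).
have [|L [C [CU szL inC outC]]] := IH (U :\: Q).
  have := cardsID Q U; rewrite (setIidPr QU); move: Un Q0; lia.
have dQC : [disjoint Q & C].
  rewrite disjoint_sym; apply: (disjointWl CU).
  by rewrite -setI_eq0 setDE -setIA [~: Q :&: Q]setIC setICr setI0.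
exists (s :: L), (Q :|: C); split.
- rewrite subUset QU (subset_trans CU)//; exact: subsetDl.
- rewrite big_disjoint_setU//= sumQ -natr1 mulrDr mulr1 addrC lerD//.
  exact: ltW.
- move=> r; rewrite inE => /orP[|/inC[s' s'L Es']].
    by rewrite inE => /andP[_ Esr]; exists s => //; rewrite mem_head.
  by exists s' => //; rewrite inE s'L orbT.
- by move=> s'; rewrite -setDDl; exact: outC.
Qed.

(** If [|g|] exceeded [eta] everywhere, steps of size at most [eta] could never change its sign
    along the progression of difference [t]. As [t] is invertible this progression covers ['F_p], so
    the sum of [g] could not vanish. *)
Lemma discrete_ivt (R : realType) (p : nat) (g : 'F_p -> R) (t : 'F_p) (eta : R) :
  t != 0 -> (forall x, `|g (x + t) - g x| <= eta) -> \sum_x g x = 0 ->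
  exists x, `|g x| <= eta.
Proof.
move=> t0.
have pos (h : 'F_p -> R) x0 : (forall x, `|h (x + t) - h x| <= eta) ->
    (forall x, eta < `|h x|) -> 0 < h x0 -> 0 < \sum_x h x.
  move=> hlip hbig hx0.
  have eta0 : 0 <= eta by apply: le_trans (hlip 0).
  have along k : 0 < h (x0 + t *+ k).
    elim: k => [|k IH]; first by rewrite mulr0n addr0.
    rewrite mulrSr addrA.
    have := hlip (x0 + t *+ k); have := hbig (x0 + t *+ k).
    by rewrite gtr0_norm// ler_norml => ? /andP[? _]; lra.
  have all_pos y : 0 < h y.
    have := along (nat_of_ord ((y - x0) / t)).
    by rewrite -mulr_natr natr_Zp mulrC divfK// addrC subrK.
  rewrite (bigD1 x0)//= ltr_pwDl// sumr_ge0// => y _; exact: ltW.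
move=> glip gsum; apply: contrapT => /forallNP nox.
have gbig x : eta < `|g x| by rewrite ltNge; apply/negP.
have [g0|g0|g0] := ltgtP 0 (g 0).
- by have := pos g 0 glip gbig g0; rewrite gsum ltxx.
- have : 0 < \sum_x - g x.
    apply: (pos _ 0) => [x|x|]; rewrite ?normrN ?oppr_gt0//.
    by rewrite -opprD normrN.
  by rewrite sumrN gsum oppr0 ltxx.
- have := gbig 0; rewrite -g0 normr0 => eta0.
  by have := le_lt_trans (glip 0) eta0; rewrite normr_lt0.
Qed.

(** * Gibbs measures attached to a character of a finite field *)

Section Gibbs.
Context {R : realType} {F : finFieldType} (e : F -> R[i]).
Implicit Types (l eps : R) (S T : seq F).
Hypothesis charD : forall x y, e (x + y) = e x * e y.
Hypothesis normc_char : forall x, normc (e x) = 1.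

Lemma char_neq0 x : e x != 0.
Proof.
by apply/eqP => ex0; have := normc_char x; rewrite ex0 normc0 => /esym/eqP; rewrite oner_eq0.
Qed.

Lemma char0 : e 0 = 1.
Proof. by apply: (mulfI (char_neq0 0)); rewrite -charD addr0 mulr1. Qed.

Lemma conj_char x : (e x)^*%C = e (- x).
Proof.
apply: (mulfI (char_neq0 x)).
by rewrite -charD subrr char0 -sqr_normcE normc_char expr1n.
Qed.

Definition chord (y : F) : R := normc (1 - e y).

Lemma chord_ge0 y : 0 <= chord y. Proof. exact: normc_ge0. Qed.

Lemma chord0 : chord 0 = 0.
Proof. by rewrite /chord char0 subrr normc0. Qed.

Lemma chord_sub x y : normc (e x - e y) = chord (y - x).
Proof.
rewrite /chord -[RHS]mul1r -(normc_char x) -normcM.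
by rewrite mulrBr mulr1 -charD [x + _]addrC subrK.
Qed.

Lemma chordN y : chord (- y) = chord y.
Proof. by rewrite -[- y]sub0r -chord_sub char0 normcB. Qed.

Lemma chordD x y : chord (x + y) <= chord x + chord y.
Proof.
have -> : chord (x + y) = normc ((1 - e x) + (e x - e (x + y))).
  by rewrite addrA subrK.
by rewrite (le_trans (le_normcD _ _))// chord_sub [x + y - x]addrC addKr.
Qed.

Definition energy (S : seq F) (x : F) : R := \sum_(s <- S) chord (s * x).

Lemma energy_ge0 S x : 0 <= energy S x.
Proof. by apply: sumr_ge0 => s _; exact: chord_ge0. Qed.

Lemma energy0 S : energy S 0 = 0.
Proof. by rewrite /energy big1// => s _; rewrite mulr0 chord0. Qed.

Lemma energyN S x : energy S (- x) = energy S x.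
Proof. by apply: eq_bigr => s _; rewrite mulrN chordN. Qed.

Lemma energyD S x y : energy S (x + y) <= energy S x + energy S y.
Proof.
by rewrite -big_split /=; apply: ler_sum => s _; rewrite mulrDr chordD.
Qed.

Lemma energy_lip S x y : `|energy S (x + y) - energy S x| <= energy S y.
Proof.
rewrite ler_norml lerBlDr [_ + energy S x]addrC energyD andbT lerBrDl.
by rewrite lerBlDr -(energyN S y) (le_trans _ (energyD _ _ _))// addrK.
Qed.

Lemma energy_cat S T x : energy (S ++ T) x = energy S x + energy T x.
Proof. by rewrite /energy big_cat. Qed.

Lemma chord_le_energy S s x : s \in S -> chord (s * x) <= energy S x.
Proof.
move=> sS; rewrite /energy (big_rem s)//= lerDl.
by apply: sumr_ge0 => t _; exact: chord_ge0.
Qed.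

Definition weight (S : seq F) (l : R) (x : F) : R := expR (- (l * energy S x)).

Definition gibbs (S : seq F) (l : R) (x : F) : R :=
  weight S l x / \sum_y weight S l y.

Lemma weight_sum_ge1 S l : 1 <= \sum_y weight S l y.
Proof.
rewrite (bigD1 0)//= {1}/weight energy0 mulr0 oppr0 expR0 lerDl.
by apply: sumr_ge0 => y _; exact: expR_ge0.
Qed.

Lemma weight_sum_gt0 S l : 0 < \sum_y weight S l y.
Proof. by rewrite (lt_le_trans ltr01)// weight_sum_ge1. Qed.

Lemma gibbs_ge0 S l x : 0 <= gibbs S l x.
Proof. by rewrite divr_ge0 ?expR_ge0// ltW// weight_sum_gt0. Qed.

Lemma gibbs_sum S l : \sum_x gibbs S l x = 1.
Proof. by rewrite -mulr_suml divff// gt_eqF// weight_sum_gt0. Qed.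

(** Approximate translation invariance, as for a Bohr set. The energy changes by at most
    [energy S t] under the shift, so [norm_expRB] bounds each difference; the weights and their
    translates have the same total [Z], whence the factor 2. *)
Lemma gibbs_shift S l t : 0 <= l ->
  \sum_x `|gibbs S l (x + t) - gibbs S l x| <= 2 * l * energy S t.
Proof.
move=> l0; set Z := \sum_y weight S l y.
have Z0 : 0 < Z := weight_sum_gt0 S l.
have shiftZ : \sum_x weight S l (x + t) = Z.
  by rewrite /Z [RHS](reindex_inj (addIr t)).
have -> : 2 * l * energy S t =
    \sum_x (l * energy S t) * (weight S l (x + t) + weight S l x) / Z.
  rewrite -mulr_suml -mulr_sumr big_split /= shiftZ -/Z.
  by rewrite mulrDr mulrDl mulfK ?gt_eqF//; ring.
apply: ler_sum => x _.
rewrite /gibbs -/Z -mulrBl normrM [`|Z^-1|]ger0_norm ?invr_ge0 ?(ltW Z0)//.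
rewrite ler_pM2r ?invr_gt0// (le_trans (norm_expRB _ _))//.
rewrite ler_wpM2r ?addr_ge0 ?expR_ge0//.
rewrite opprK addrC -mulrBr normrM ger0_norm// ler_wpM2l//.
by rewrite distrC energy_lip.
Qed.

Lemma gibbs_average_shift S l (h : F -> R) x t : 0 <= l ->
  (forall y, `|h y| <= 1) ->
  `|\sum_b gibbs S l b * h (x + t + b) - \sum_b gibbs S l b * h (x + b)|
    <= 2 * l * energy S t.
Proof.
move=> l0 h1; rewrite [X in _ - X](reindex_inj (addIr t)) /= -sumrB.
rewrite (le_trans (ler_norm_sum _ _ _))// (le_trans _ (gibbs_shift S t l0))//.
apply: ler_sum => b _.
by rewrite -addrA [t + b]addrC -mulrBl normrM distrC ler_piMr.
Qed.

(* The Gibbs variational principle: energy is at most entropy. *)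
Lemma gibbs_energy S l : l * \sum_x gibbs S l x * energy S x <= ln #|F|%:R.
Proof.
set L := ln _; set Z := \sum_y weight S l y.
have Z0 : 0 < Z := weight_sum_gt0 S l.
have F0 : (0 : R) < #|F|%:R by rewrite ltr0n; apply/card_gt0P; exists 0.
have expL : expR (- L) = #|F|%:R^-1 by rewrite expRN lnK.
(* This is [1 + y <= expR y] at [y = l * energy S x - L], times the weight. Summed over [x], it
   gives the claim because [Z >= 1]. *)
have key x : weight S l x * (l * energy S x - L) <= #|F|%:R^-1 - weight S l x.
  have := expR_ge1Dx (l * energy S x - L).
  rewrite expRD expL => h.
  have h2 := ler_wpM2l (expR_ge0 (- (l * energy S x))) h.
  move: h2; rewrite mulrA -expRD addNr expR0 mul1r mulrDr mulr1 -/(weight S l x).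
  by move=> h2; rewrite lerBrDl.
have : \sum_x weight S l x * (l * energy S x - L) <= 1 - Z.
  apply: le_trans (ler_sum _ (fun x _ => key x)) _.
  by rewrite sumrB sumr_const -[_ *+ _]mulr_natl divff ?gt_eqF.
under eq_bigr do rewrite mulrBr.
rewrite sumrB -mulr_suml -/Z => h.
have -> : l * \sum_x gibbs S l x * energy S x =
    (\sum_x weight S l x * (l * energy S x)) / Z.
  rewrite mulr_sumr mulr_suml; apply: eq_bigr => x _.
  by rewrite /gibbs -/Z; ring.
rewrite ler_pdivrMr//.
have := weight_sum_ge1 S l; rewrite -/Z; lra.
Qed.

Definition gibbs_hat S l (r : F) : R[i] :=
  \sum_b (gibbs S l b)%:C%C * e (r * b).

(** Summation by parts: the factor [1 - e (r * t)] replaces the measure by its difference under the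
    shift [t], which is small in L^1. So a frequency with large transform is nearly trivial wherever
    the energy is small. *)
Lemma gibbs_hat_chord S l r t : 0 <= l ->
  normc (gibbs_hat S l r) * chord (r * t) <= 2 * l * energy S t.
Proof.
move=> l0; rewrite /chord -normcM.
have -> : gibbs_hat S l r * (1 - e (r * t)) =
   \sum_b (gibbs S l (b + t) - gibbs S l b)%:C%C * e (r * (b + t)).
  under eq_bigr do rewrite rmorphB mulrBl.
  rewrite sumrB mulrBr mulr1; congr (_ - _).
    by rewrite /gibbs_hat (reindex_inj (addIr t)).
  by rewrite mulr_suml; apply: eq_bigr => b _; rewrite mulrDr charD mulrA.
rewrite (le_trans (ler_normc_sum _ _ _))// (le_trans _ (gibbs_shift S t l0))//.
by apply: ler_sum => b _; rewrite normcM normc_char mulr1 normc_real.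
Qed.

Definition gibbs_chord S l r : R := \sum_b gibbs S l b * chord (r * b).

Lemma gibbs_hat_ge S l r : 1 - gibbs_chord S l r <= normc (gibbs_hat S l r).
Proof.
rewrite lerBlDr -lerBlDl.
have -> : gibbs_chord S l r = \sum_b normc ((gibbs S l b)%:C%C * (1 - e (r * b))).
  by apply: eq_bigr => b _; rewrite normcM normc_real ger0_norm ?gibbs_ge0.
apply: le_trans (ler_normc_sum _ _ _).
under eq_bigr do rewrite mulrBr mulr1.
rewrite sumrB -/(gibbs_hat S l r) -rmorph_sum gibbs_sum rmorph1.
rewrite lerBlDr.
have {1}-> : 1 = normc ((1 - gibbs_hat S l r) + gibbs_hat S l r).
  by rewrite subrK normc1.
exact: le_normcD.
Qed.

(* Frequencies correlating with [gibbs S l] around a centre in [T] become nearly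
   trivial on the colder measure [gibbs (S ++ T) l']. *)
Lemma gibbs_chord_refine S T l l' eps r s :
  0 <= l -> 0 < l' -> 0 < eps -> (s == 0) || (s \in T) ->
  eps <= normc (gibbs_hat S l (r - s)) ->
  gibbs_chord (S ++ T) l' r <= (2 * l / eps + 1) * (ln #|F|%:R / l').
Proof.
move=> l0 l'0 eps0 sT hs.
(* Split [r] as [(r - s) + s]: the correlation controls [r - s] through the energy of [S], and [s]
   is either zero or a term of the energy of [T]. *)
have pt b : chord (r * b) <= (2 * l / eps + 1) * energy (S ++ T) b.
  have -> : r * b = (r - s) * b + s * b by rewrite -mulrDl subrK.
  rewrite (le_trans (chordD _ _))// [leRHS]mulrDl mul1r lerD//.
    have h := gibbs_hat_chord S (r - s) b l0.
    have h2 : eps * chord ((r - s) * b) <= 2 * l * energy (S ++ T) b.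
      apply: le_trans (ler_wpM2r (chord_ge0 _) hs) _.
      rewrite (le_trans h)// ler_wpM2l ?mulr_ge0//.
      by rewrite energy_cat lerDl energy_ge0.
    by rewrite mulrAC ler_pdivlMr// mulrC.
  case/orP: sT => [/eqP->|sT]; first by rewrite mul0r chord0 energy_ge0.
  rewrite energy_cat (le_trans (chord_le_energy _ sT))//.
  by rewrite lerDr energy_ge0.
apply: (@le_trans _ _ (\sum_b gibbs (S ++ T) l' b *
   ((2 * l / eps + 1) * energy (S ++ T) b))).
  by apply: ler_sum => b _; rewrite ler_wpM2l ?gibbs_ge0.
under eq_bigr do rewrite mulrCA.
rewrite -mulr_sumr ler_wpM2l//.
  by rewrite addr_ge0// divr_ge0 ?mulr_ge0// ltW.
by rewrite ler_pdivlMr// mulrC gibbs_energy.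
Qed.

Lemma gibbs_hat_le1 S l r : normc (gibbs_hat S l r) <= 1.
Proof.
rewrite (le_trans (ler_normc_sum _ _ _))// -(gibbs_sum S l).
apply: ler_sum => b _.
by rewrite normcM normc_char mulr1 normc_real ger0_norm ?gibbs_ge0.
Qed.

(** Expanding the square gives a quadratic form with kernel [gibbs_hat S l (r - s)]. For each [s],
    the [r] with large kernel carry mass at most [eps], and the others have kernel below [eps] and
    total mass at most 1. *)
Lemma second_moment S l eps (V : {set F}) (c : F -> R[i]) :
  0 <= eps -> \sum_(r in V) normc (c r) <= 1 ->
  (forall s, s \in V ->
     \sum_(r in V | eps <= normc (gibbs_hat S l (r - s))) normc (c r) <= eps) ->
  \sum_b gibbs S l b * normc (\sum_(r in V) c r * e (- (r * b))) ^+ 2 <= 2 * eps.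
Proof.
move=> eps0 c1 cV.
set M := (X in X <= _).
have M0 : 0 <= M.
  by apply: sumr_ge0 => b _; rewrite mulr_ge0 ?sqr_ge0 ?gibbs_ge0.
(* [M] is real and nonnegative, so it equals its modulus and the triangle inequality applies to the
   expanded form. *)
have -> : M = normc (\sum_(s in V) \sum_(r in V)
    c s * (c r)^*%C * gibbs_hat S l (r - s)).
  rewrite -[LHS]ger0_norm// -normc_real; congr normc.
  rewrite /M rmorph_sum /=.
  transitivity (\sum_b \sum_(s in V) \sum_(r in V)
     c s * (c r)^*%C * ((gibbs S l b)%:C%C * e ((r - s) * b))).
    apply: eq_bigr => b _; rewrite rmorphM /= sqr_normcE rmorph_sum /=.
    rewrite big_distrlr /= mulr_sumr; apply: eq_bigr => s _.
    rewrite mulr_sumr; apply: eq_bigr => r _.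
    rewrite (rmorphM (@conjc R)) /= conj_char opprK mulrBl addrC charD.
    by ring.
  rewrite exchange_big /=; apply: eq_bigr => s _.
  rewrite exchange_big /=; apply: eq_bigr => r _.
  by rewrite -mulr_sumr.
rewrite (le_trans (ler_normc_sum _ _ _))//.
apply: (@le_trans _ _ (\sum_(s in V) normc (c s) * (2 * eps))); last first.
  by rewrite -mulr_suml -[leRHS]mul1r ler_wpM2r// mulr_ge0.
apply: ler_sum => s sV; rewrite (le_trans (ler_normc_sum _ _ _))//.
under eq_bigr do rewrite !normcM normc_conj -mulrA.
rewrite -mulr_sumr ler_wpM2l ?normc_ge0//.
rewrite (bigID (fun r => eps <= normc (gibbs_hat S l (r - s))))/=.
have -> : 2 * eps = eps + eps by ring.
rewrite lerD//.
  rewrite (le_trans _ (cV s sV))//; apply: ler_sum => r _.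
  by rewrite ler_piMr ?normc_ge0 ?gibbs_hat_le1.
apply: (@le_trans _ _ (\sum_(r in V) normc (c r) * eps)).
  rewrite [leRHS](bigID (fun r => eps <= normc (gibbs_hat S l (r - s))))/=.
  rewrite ler_wpDl//.
    by apply: sumr_ge0 => r _; rewrite mulr_ge0 ?normc_ge0.
  apply: ler_sum => r /andP[_]; rewrite -ltNge => /ltW h.
  by rewrite ler_wpM2l ?normc_ge0.
by rewrite -mulr_suml ler_piMl.
Qed.

(** Cauchy-Schwarz for a probability measure, through [h <= h ^ 2 / (2 eps) + eps / 2]. *)
Lemma first_moment S l eps (h : F -> R) : 0 < eps ->
  \sum_b gibbs S l b * h b ^+ 2 <= eps ^+ 2 -> \sum_b gibbs S l b * h b <= eps.
Proof.
move=> eps0 h2.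
apply: (@le_trans _ _ (\sum_b gibbs S l b * ((2 * eps)^-1 * h b ^+ 2 + eps / 2))).
  apply: ler_sum => b _; rewrite ler_wpM2l ?gibbs_ge0//.
  have : 0 <= (2 * eps)^-1 * (h b - eps) ^+ 2.
    by rewrite mulr_ge0 ?sqr_ge0// invr_ge0 mulr_ge0// ltW.
  have -> : (2 * eps)^-1 * (h b - eps) ^+ 2 =
     (2 * eps)^-1 * h b ^+ 2 + eps / 2 - h b by field; rewrite gt_eqF.
  by rewrite subr_ge0.
under eq_bigr do rewrite mulrDr mulrCA.
rewrite big_split /= -mulr_sumr -mulr_suml gibbs_sum mul1r.
have : (2 * eps)^-1 * \sum_b gibbs S l b * h b ^+ 2 <= (2 * eps)^-1 * eps ^+ 2.
  by rewrite ler_wpM2l// invr_ge0 mulr_ge0// ltW.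
have -> : (2 * eps)^-1 * eps ^+ 2 = eps / 2 by field; rewrite gt_eqF.
by lra.
Qed.

(** * Fourier mass on frequencies nearly trivial for a Gibbs measure *)

Variables (a : F -> R[i]) (f : F -> R).
Hypothesis fE : forall x, (f x)%:C%C = \sum_r a r * e (- (r * x)).
Hypothesis a_le1 : \sum_r normc (a r) <= 1.

Definition mass (V : {set F}) : R := \sum_(r in V) normc (a r).

Definition explained S l eps : {set F} := [set r | gibbs_chord S l r <= eps].

Lemma mass_le1 V : mass V <= 1.
Proof.
apply: le_trans a_le1; rewrite /mass [leRHS](bigID (mem V))/= lerDl.
by apply: sumr_ge0 => r _; exact: normc_ge0.
Qed.

Lemma mass_sub (V W : {set F}) : V \subset W -> mass V <= mass W.
Proof.
move=> /setIidPr VW; rewrite /mass [leRHS](big_setID V)/= VW lerDl.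
by apply: sumr_ge0 => r _; exact: normc_ge0.
Qed.

(** Near [x], [f] is the sum of a nearly constant part from the explained frequencies [A], a part
    from the clustered frequencies [C], and a remainder [V] small in mean square. A function with
    [|f| >= d] and small average is far from constant, so [C] must carry mass; the colder measure
    explains both [A] and [C]. *)
Lemma mass_increment S l l' (d : R) x : 0 <= l -> 0 < l' -> 0 < d <= 1 ->
  (forall y, d <= `|f y|) ->
  `|\sum_b gibbs S l b * f (x + b)| <= d / 12 ->
  (2 * l / (d ^+ 2 / 128) + 1) * (ln #|F|%:R / l') <= d / 12 ->
  exists T,
    mass (explained S l (d / 12)) + d / 4
      <= mass (explained (S ++ T) l' (d / 12)) /\
    mass (explained S l (d / 12)) + d ^+ 2 / 128 * (size T)%:R
      <= mass (explained (S ++ T) l' (d / 12)).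
Proof.
move=> l0 l'0 /andP[d0 d1] fbig fmean cold.
set A := explained S l (d / 12); set eps := d ^+ 2 / 128.
have eps0 : 0 < eps by rewrite divr_gt0// exprn_gt0.
(* This makes every frequency of [A] correlate with the centre 0, so that cooling keeps it
   explained. *)
have eps1 : eps <= 1 - d / 12.
  have : d ^+ 2 <= 1 by rewrite expr_le1// ltW.
  rewrite /eps; lra.
have [T [C [CA szT inC outC]]] := greedy_clusters
   (fun s r => eps <= normc (gibbs_hat S l (r - s))) (~: A) eps0
   (fun r => normc_ge0 (a r)).
exists T; set A' := explained _ _ _.
have AA' : A \subset A'.
  apply/subsetP => r; rewrite !inE => rA; apply: le_trans cold.
  apply: (@gibbs_chord_refine _ _ _ _ _ _ 0) => //.
    by rewrite eqxx.
  rewrite subr0 (le_trans eps1)// (le_trans _ (gibbs_hat_ge _ _ _))//.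
  by rewrite lerB.
have CA' : C \subset A'.
  apply/subsetP => r /inC[s sT Es]; rewrite inE; apply: le_trans cold.
  apply: (@gibbs_chord_refine _ _ _ _ _ _ s) => //.
  by rewrite sT orbT.
have dAC : [disjoint A & C].
  by rewrite disjoint_sym disjoints_subset.
have massA' : mass A + mass C <= mass A'.
  rewrite /mass -big_disjoint_setU//=; apply: mass_sub.
  by rewrite subUset AA' CA'.
suff dC : d / 4 <= mass C.
  by split; apply: le_trans massA'; rewrite lerD2l.
set V := ~: A :\: C in outC.
set c := fun r => a r * e (- (r * x)).
have normc_c r : normc (c r) = normc (a r) by rewrite normcM normc_char mulr1.
set g := fun (W : {set F}) b => \sum_(r in W) c r * e (- (r * b)).
have fsplit b : (f (x + b))%:C%C = g A b + g C b + g V b.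
  have -> : (f (x + b))%:C%C = \sum_r c r * e (- (r * b)).
    rewrite fE; apply: eq_bigr => r _.
    by rewrite mulrDr opprD charD mulrA.
  rewrite (bigID (mem A))/= -addrA; congr (_ + _).
  rewrite (eq_bigl (mem (~: A))); last by move=> r; rewrite !inE.
  by rewrite (big_setID C)/= (setIidPr CA).
(* The choice [eps = d ^ 2 / 128] makes the second moment bound [2 * eps] equal to [(d / 8) ^ 2]. *)
have hV : \sum_b gibbs S l b * normc (g V b) <= d / 8.
  apply: first_moment; first by rewrite divr_gt0.
  have -> : (d / 8) ^+ 2 = 2 * eps by rewrite /eps; field.
  apply: second_moment; first exact: ltW.
    under eq_bigr do rewrite normc_c; exact: mass_le1.
  by move=> s _; under eq_bigr do rewrite normc_c; exact: outC.
have hC b : normc (g C b) <= mass C.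
  rewrite (le_trans (ler_normc_sum _ _ _))//; apply: ler_sum => r _.
  by rewrite normcM normc_c normc_char mulr1.
(* The explained part of [f] at [x] itself, the constant near which that part stays. *)
set q := \sum_(r in A) c r.
have hA : \sum_b gibbs S l b * normc (g A b - q) <= d / 12.
  apply: (@le_trans _ _ (\sum_b \sum_(r in A)
     normc (a r) * (gibbs S l b * chord (r * b)))).
    apply: ler_sum => b _; rewrite /g /q -sumrB.
    apply: (@le_trans _ _ (gibbs S l b *
        \sum_(r in A) normc (a r) * chord (r * b))).
      rewrite ler_wpM2l ?gibbs_ge0// (le_trans (ler_normc_sum _ _ _))//.
      apply: ler_sum => r _.
      rewrite -[X in _ - X]mulr1 -mulrBr normcM normc_c normcB.
      by rewrite -/(chord _) chordN.
    rewrite mulr_sumr; apply: ler_sum => r _; by rewrite mulrCA.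
  rewrite exchange_big /=.
  apply: (@le_trans _ _ (\sum_(r in A) normc (a r) * (d / 12))).
    apply: ler_sum => r; rewrite inE => rA.
    by rewrite -mulr_sumr ler_wpM2l ?normc_ge0.
  by rewrite -mulr_suml ler_piMl ?divr_ge0 ?(ltW d0)//; exact: mass_le1.
set m := mass C in dAC hC *.
have hfq : \sum_b gibbs S l b * normc ((f (x + b))%:C%C - q) <= d / 12 + m + d / 8.
  apply: (@le_trans _ _ (\sum_b (gibbs S l b * normc (g A b - q) +
      gibbs S l b * m + gibbs S l b * normc (g V b)))).
    apply: ler_sum => b _; rewrite -!mulrDr ler_wpM2l ?gibbs_ge0// fsplit.
    have -> : g A b + g C b + g V b - q = (g A b - q) + g C b + g V b by ring.
    rewrite (le_trans (le_normcD _ _))// lerD2r (le_trans (le_normcD _ _))//.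
    by rewrite lerD2l.
  rewrite !big_split /= -mulr_suml gibbs_sum mul1r.
  by rewrite !lerD.
(* [q] is the average of [f] minus the average of [f - q], and both are controlled. *)
have hq : normc q <= d / 12 + (d / 12 + m + d / 8).
  have -> : q = (\sum_b gibbs S l b * f (x + b))%:C%C
      - \sum_b (gibbs S l b)%:C%C * ((f (x + b))%:C%C - q).
    under [X in _ - X]eq_bigr do rewrite mulrBr.
    rewrite sumrB -mulr_suml -rmorph_sum gibbs_sum mul1r.
    rewrite rmorph_sum /=.
    by under [X in X - _]eq_bigr do rewrite rmorphM /=; rewrite opprB addrC subrK.
  rewrite (le_trans (le_normcD _ _))// normcN normc_real lerD//.
  apply: le_trans hfq; rewrite (le_trans (ler_normc_sum _ _ _))//.
  apply: ler_sum => b _.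
  by rewrite normcM normc_real ger0_norm ?gibbs_ge0.
have : d <= normc q + (d / 12 + m + d / 8).
  apply: (@le_trans _ _ (\sum_b gibbs S l b * `|f (x + b)|)).
    rewrite -[leLHS]mul1r -(gibbs_sum S l) mulr_suml.
    by apply: ler_sum => b _; rewrite ler_wpM2l ?gibbs_ge0.
  apply: (@le_trans _ _ (\sum_b (gibbs S l b * normc q +
      gibbs S l b * normc ((f (x + b))%:C%C - q)))).
    apply: ler_sum => b _; rewrite -mulrDr ler_wpM2l ?gibbs_ge0//.
    rewrite -normc_real -[X in normc X <= _](subrK q) addrC.
    exact: le_normcD.
  rewrite big_split /= -mulr_suml gibbs_sum mul1r.
  by rewrite lerD2l.
(* Together, [d <= d / 12 + 2 * (d / 12 + m + d / 8) = d / 2 + 2 * m]. *)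
by lra.
Qed.

End Gibbs.

(** * The complex exponential on the real line *)

Section Expi.
Context {R : realType}.
Implicit Types s t : R.

Lemma expiD s t : expi (s + t) = expi s * expi t.
Proof. by rewrite /expi cosD sinD; simpc; rewrite [cos s * sin t + _]addrC. Qed.

Lemma normc_expi s : normc (expi s) = 1.
Proof. by rewrite /expi /= cos2Dsin2 sqrtr1. Qed.

Lemma expi_periodic s n : expi (s + (2 * pi) * n%:R) = expi s.
Proof.
rewrite mulr_natr mulr_natl /expi.
by rewrite (periodicn (@cosD2pi R)) (periodicn (@sinD2pi R)).
Qed.

Lemma lipschitz_of_derive (h h' : R -> R) :
  (forall x : R, is_derive x (1 : R) h (h' x)) -> (forall x, `|h' x| <= 1) ->
  forall s t, `|h s - h t| <= `|s - t|.
Proof.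
move=> dh h'1.
have lt_case s t : t < s -> `|h s - h t| <= `|s - t|.
  move=> ts; have [|x _ ->] := @MVT _ h h' t s ts (fun x _ => dh x).
    apply: derivable_within_continuous => x _.
    exact: ex_derive.
  by rewrite normrM ler_piMl.
move=> s t; have [/lt_case|/lt_case//|->] := ltgtP s t; last by rewrite !subrr.
by rewrite distrC [`|t - s|]distrC.
Qed.

Lemma expi_lipschitz s t : normc (expi s - expi t) <= 2 * `|s - t|.
Proof.
have -> : expi s - expi t = ((cos s - cos t) +i* (sin s - sin t))%C by [].
rewrite (le_trans (normc_leD _ _))// mulr2n mulrDl mul1r lerD//.
  apply: (@lipschitz_of_derive (@cos R) (fun x => - sin x)) => x.
  by rewrite normrN sin_max.
apply: (@lipschitz_of_derive (@sin R) (@cos R)) => x.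
exact: cos_max.
Qed.

End Expi.

(** * The additive character of ['F_p]: Fourier inversion and Dirichlet approximation *)

Section AdditiveCharacter.
Context {R : realType} {p : nat}.
Hypothesis p_prime : prime p.
Hypothesis p_ge3 : (3 <= p)%N.

Let p_gt0 : (0 : R) < p%:R.
Proof. by rewrite ltr0n prime_gt0. Qed.

Definition zeta (y : 'F_p) : R[i] := expi (2 * pi * (nat_of_ord y)%:R / p%:R).

Lemma zeta_nat n : zeta n%:R = expi (2 * pi * n%:R / p%:R).
Proof.
rewrite /zeta val_Fp_nat// [in RHS](divn_eq n p) natrD natrM.
rewrite -[LHS](expi_periodic _ (n %/ p)%N); congr expi.
by field; rewrite gt_eqF.
Qed.

Lemma zetaD x y : zeta (x + y) = zeta x * zeta y.
Proof.
rewrite -[x in LHS]natr_Zp -[y in LHS]natr_Zp -natrD zeta_nat natrD.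
by rewrite mulrDr mulrDl expiD.
Qed.

Lemma normc_zeta x : normc (zeta x) = 1.
Proof. exact: normc_expi. Qed.

Lemma zetaM (x y : 'F_p) : zeta (x * y) = expi (2 * pi * (x * y)%N%:R / p%:R).
Proof. by rewrite -[x in LHS]natr_Zp -[y in LHS]natr_Zp -natrM zeta_nat. Qed.

(** If [zeta r = 1], then taking the multiple [r^-1] of [r] gives [zeta 1 = 1]. But [2 * pi / p] is
    a nonzero point of [[0, pi]], where the cosine is injective. *)
Lemma zeta_neq1 r : r != 0 -> zeta r != 1.
Proof.
move=> r0; apply/eqP => zr.
have zk k : zeta (r *+ k) = 1.
  elim: k => [|k IH]; first by rewrite mulr0n (char0 zetaD normc_zeta).
  by rewrite mulrS zetaD zr IH mulr1.
have := zk (nat_of_ord (r^-1)); rewrite -mulr_natr natr_Zp divff//.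
rewrite -(mulr1n 1) zeta_nat mulr1 => -[cos1 _].
have : (2 * pi / p%:R : R) = 0.
  apply: cos_inj; rewrite ?cos0// in_itv /= ?lexx ?pi_ge0//.
  rewrite divr_ge0 ?mulr_ge0 ?pi_ge0 ?(ltW p_gt0)//= ler_pdivrMr// mulrC.
  by rewrite ler_wpM2l ?pi_ge0// ler_nat ltnW.
by move=> /eqP; rewrite gt_eqF// divr_gt0// mulr_gt0// pi_gt0.
Qed.

(** Translating the variable by 1 multiplies the sum by [zeta r], which is not 1. *)
Lemma sum_zeta r : r != 0 -> \sum_x zeta (r * x) = 0.
Proof.
move=> r0; set Z := \sum_x _.
have : Z = Z * zeta r.
  rewrite {1}/Z (reindex_inj (addIr 1)) /= mulr_suml; apply: eq_bigr => x _.
  by rewrite mulrDr mulr1 zetaD.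
move/eqP; rewrite -subr_eq0 -{1}[Z]mulr1 -mulrBr mulf_eq0 => /orP[/eqP//|].
by rewrite subr_eq0 eq_sym (negbTE (zeta_neq1 r0)).
Qed.

Lemma fourier_inversion (f : 'F_p -> R) x :
  (f x)%:C%C = \sum_r fourier f r * zeta (- (r * x)).
Proof.
transitivity (p%:R^-1 * \sum_y (f y)%:C%C * \sum_r zeta (r * (y - x))); last first.
  under eq_bigr do rewrite mulr_sumr.
  rewrite exchange_big /= mulr_sumr; apply: eq_bigr => r _.
  rewrite /fourier -mulrA; congr (_ * _); rewrite mulr_suml.
  apply: eq_bigr => y _; rewrite -zetaM mulrBr zetaD mulrA//.
rewrite (bigD1 x)//= [X in _ + X]big1 ?addr0 => [|y yx]; last first.
  under eq_bigr do rewrite mulrC.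
  by rewrite sum_zeta ?mulr0// subr_eq0.
under eq_bigr do rewrite subrr mulr0 (char0 zetaD normc_zeta).
rewrite sumr_const card_Fp// mulrCA mulVf ?mulr1//.
by rewrite pnatr_eq0 -lt0n prime_gt0.
Qed.

(** Pigeonhole: a cell records, for each [s], which of [M] arcs contains [s * x]. There are fewer
    cells than elements, and [t] is the difference of two elements sharing a cell. *)
Lemma dirichlet (S : seq 'F_p) (M : nat) : (0 < M)%N -> (M ^ size S < p)%N ->
  exists2 t, t != 0 & forall s, s \in S -> chord zeta (s * t) <= 16 / M%:R.
Proof.
clear p_ge3; case: M => // M _ Mp.
pose cell (x : 'F_p) := [ffun i : 'I_(size S) =>
  inord (nat_of_ord (nth 0 S i * x) * M.+1 %/ p) : 'I_M.+1].
have : ~~ injectiveb cell.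
  apply/negP => /injectiveP/leq_card.
  by rewrite card_Fp// card_ffun !card_ord leqNgt Mp.
case/injectivePn => x [y xy cxy].
exists (x - y) => [|s sS]; first by rewrite subr_eq0.
have cell_lt (z : 'F_p) : (z * M.+1 %/ p < M.+1)%N.
  rewrite ltn_divLR ?prime_gt0// mulnC ltn_pmul2l//.
  by rewrite -[X in (_ < X)%N](Fp_cast p_prime).
have : (nat_of_ord (s * x)%R * M.+1 %/ p = nat_of_ord (s * y)%R * M.+1 %/ p)%N.
  have si : (index s S < size S)%N by rewrite index_mem.
  move/ffunP: cxy => /(_ (Ordinal si)); rewrite !ffunE /= nth_index//.
  by move/(congr1 val); rewrite /= !inordK; [|exact: (cell_lt (s * y))|exact: (cell_lt (s * x))].
set a := nat_of_ord (s * x); set b := nat_of_ord (s * y) => ab.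
(* [a * M] and [b * M] have the same quotient by [p], so they differ by less than [p]. *)
have abp : `|(a%:R - b%:R) * M.+1%:R| <= p%:R :> R.
  have p0 := prime_gt0 p_prime.
  have := ltn_pmod (a * M.+1) p0; have := ltn_pmod (b * M.+1) p0.
  have := divn_eq (a * M.+1) p; have := divn_eq (b * M.+1) p; rewrite ab.
  set q := (_ %/ _)%N; set r1 := (_ %% _)%N; set r2 := (_ %% _)%N.
  move=> e1 e2 h1 h2.
  rewrite mulrBl -!natrM e1 e2 !natrD opprD addrACA subrr add0r.
  rewrite ler_norml; apply/andP; split.
    by rewrite lerBrDl lerBlDr -natrD ler_nat; lia.
  by rewrite lerBlDr -natrD ler_nat; lia.
rewrite mulrBr -(chord_sub zetaD normc_zeta) /zeta -/a -/b.
rewrite (le_trans (expi_lipschitz _ _))// distrC.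
have M0 : (0 : R) < M.+1%:R by rewrite ltr0n.
have -> : 2 * pi * a%:R / p%:R - 2 * pi * b%:R / p%:R =
    (2 * pi / (p%:R * M.+1%:R)) * ((a%:R - b%:R) * M.+1%:R) :> R.
  by field; rewrite !gt_eqF.
have pos : 0 <= 2 * pi / (p%:R * M.+1%:R) :> R.
  by rewrite divr_ge0 ?mulr_ge0 ?pi_ge0// ltW.
rewrite normrM ger0_norm//.
apply: (@le_trans _ _ (2 * (2 * pi / (p%:R * M.+1%:R) * p%:R))).
  by rewrite ler_wpM2l// ler_wpM2l.
have -> : 2 * (2 * pi / (p%:R * M.+1%:R) * p%:R) = 4 * pi / M.+1%:R :> R.
  by field; rewrite !gt_eqF.
rewrite ler_pM2r ?invr_gt0//.
(* The constant 16 comes from [4 * pi <= 16]. *)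
have := pihalf_lt2 R; lra.
Qed.

End AdditiveCharacter.

(** [expR (-1) >= (5 / 6) ^ 6 > 1 / 3]. It makes [ln (ln p)] positive from [p = 3] on. *)
Lemma ln3_gt1 (R : realType) : 1 < ln (3 : R).
Proof.
rewrite -[X in X < _](expRK 1) ltr_ln ?posrE ?expR_gt0//.
have h : 5 / 6 <= expR (- 6^-1) :> R.
  by apply: le_trans (expR_ge1Dx _); lra.
have : (5 / 6) ^+ 6 <= expR (- 6^-1) ^+ 6 :> R.
  by rewrite lerXn2r// nnegrE ?expR_ge0//; lra.
rewrite -expRM_natr -[6%:R]/(6 : R) mulNr mulVf ?pnatr_eq0// expRN => h6.
rewrite -ltf_pV2 ?posrE ?expR_gt0//; apply: lt_le_trans h6; lra.
Qed.

(** * Mass iteration and choice of constants *)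

Section MainArgument.
Context {R : realType} (p : nat) (f : 'F_p -> R).
Hypothesis p_prime : prime p.
Hypothesis p_ge3 : (3 <= p)%N.
Hypothesis f_mean : mean f = 0.
Hypothesis f_l1 : fourier_l1 f <= 1.

Lemma sum_mean0 : \sum_x f x = 0.
Proof.
move/eqP: f_mean; rewrite mulf_eq0 invr_eq0 pnatr_eq0 => /orP[p0|/eqP//].
by have := prime_gt0 p_prime; rewrite lt0n p0.
Qed.

Lemma norm_le1 x : `|f x| <= 1.
Proof.
apply: le_trans f_l1; rewrite -normc_real (fourier_inversion p_prime p_ge3).
rewrite (le_trans (ler_normc_sum _ _ _))//; apply: ler_sum => r _.
by rewrite normcM normc_zeta mulr1.
Qed.

(** The local averages sum to zero over [x] because [f] does, and a Dirichlet shift [t] changes them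
    little, so [discrete_ivt] applies. *)
Lemma small_average (S : seq 'F_p) (l : R) (M : nat) : 0 <= l ->
  (0 < M)%N -> (M ^ size S < p)%N ->
  exists x, `|\sum_b gibbs zeta S l b * f (x + b)|
    <= 2 * l * ((size S)%:R * (16 / M%:R)).
Proof.
move=> l0 M0 Mp; have [t t0 ht] := dirichlet (R := R) p_prime M0 Mp.
have zD := zetaD (R := R) p_prime; have zn := normc_zeta (R := R) (p := p).
apply: (discrete_ivt t0) => [x|].
  apply: le_trans (gibbs_average_shift zD zn S x t l0 norm_le1) _.
  rewrite ler_wpM2l ?mulr_ge0// /energy.
  rewrite mulr_natl -iter_addr_0 -count_predT -big_const_seq big_seq [leRHS]big_seq.
  by apply: ler_sum => s; exact: ht.
rewrite exchange_big /= big1// => b _.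
have := sum_mean0; rewrite (reindex_inj (addIr b)) /= -mulr_sumr => ->.
exact: mulr0.
Qed.

(** Induction on [j] with [mass_increment], cooling from [Q ^ j] to [Q ^ j.+1]. The mass gained
    never exceeds 1, which bounds [j] and [size S] as [room] demands. *)
Lemma mass_iteration (d Q : R) : 0 < d <= 1 -> 1 <= Q ->
  (forall y, d <= `|f y|) ->
  (48 * 96) * ln p%:R / d ^+ 3 <= Q ->
  (forall j n : nat, j%:R * d <= 4 -> n%:R * d ^+ 2 <= 128 ->
     exists2 M : nat, (192 * 256) * Q ^+ j / d ^+ 3 <= M%:R & (M ^ n < p)%N) ->
  forall j : nat, exists S,
    j%:R * (d / 4) <= mass (fourier f) (explained zeta S (Q ^+ j) (d / 12)) /\
    d ^+ 2 / 128 * (size S)%:R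
      <= mass (fourier f) (explained zeta S (Q ^+ j) (d / 12)).
Proof.
move=> /andP[d0 d1] Q1 fbig Qbig room; elim=> [|j [S [massj massS]]].
  exists [::]; rewrite mul0r mulr0.
  by split; apply: sumr_ge0 => r _; exact: normc_ge0.
have zD := zetaD (R := R) p_prime; have zn := normc_zeta (R := R) (p := p).
have Q0 : 0 < Q by apply: lt_le_trans Q1.
set l := Q ^+ j; have l1 : 1 <= l by rewrite exprn_ege1.
have l0 : 0 < l by apply: lt_le_trans l1.
have mass1 := mass_le1 f_l1 (explained zeta S l (d / 12)).
have jd : j%:R * d <= 4 by have := le_trans massj mass1; lra.
have nd : (size S)%:R * d ^+ 2 <= 128 by have := le_trans massS mass1; lra.
have [M Mbig Mp] := room j (size S) jd nd.
have M0 : (0 : R) < M%:R.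
  by apply: lt_le_trans Mbig; rewrite divr_gt0 ?exprn_gt0// mulr_gt0.
have [|x hx] := small_average (ltW l0) _ Mp; first by rewrite ltr0n in M0.
have [|||T [T1 T2]] := @mass_increment _ _ zeta zD zn _ _
    (fourier_inversion p_prime p_ge3 f) f_l1 S l (Q ^+ j.+1) d x
    (ltW l0) (exprn_gt0 _ Q0) _ fbig.
- by rewrite d0.
(* With [size S <= 128 / d ^ 2], the bound [32 * l * size S / M] is at most [d / 12] once
   [M >= 32 * 128 * 12 * l / d ^ 3]; this product of constants is [192 * 256]. *)
- apply: le_trans hx _.
  have h1 : (192 * 256) * l <= M%:R * d ^+ 3 by rewrite -ler_pdivrMr ?exprn_gt0.
  have -> : 2 * l * ((size S)%:R * (16 / M%:R)) =
    ((192 * 256) * l) * ((size S)%:R * d ^+ 2) / ((12 * 128) * (M%:R * d ^+ 2)) :> R.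
    by field; rewrite !gt_eqF.
  rewrite ler_pdivrMr ?mulr_gt0 ?exprn_gt0//.
  have -> : d / 12 * ((12 * 128) * (M%:R * d ^+ 2)) = (M%:R * d ^+ 3) * 128 by field.
  by rewrite ler_pM ?mulr_ge0 ?exprn_ge0// ltW.
(* Here [256 * l + d ^ 2 <= 384 * l], and [12 * 384 = 48 * 96] is the constant in the lower bound on
   [Q]. *)
- rewrite card_Fp// (exprS Q) -/l.
  set L := ln p%:R in Qbig *.
  have L0 : 0 <= L by rewrite ln_ge0// ler1n prime_gt0.
  have h1 : (48 * 96) * L <= Q * d ^+ 3 by rewrite -ler_pdivrMr ?exprn_gt0.
  have -> : (2 * l / (d ^+ 2 / 128) + 1) * (L / (Q * l)) =
    (256 * l + d ^+ 2) * L / (Q * l * d ^+ 2) by field; rewrite !gt_eqF.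
  rewrite ler_pdivrMr ?mulr_gt0 ?exprn_gt0//.
  have -> : d / 12 * (Q * l * d ^+ 2) = l / 12 * (Q * d ^+ 3) by field.
  apply: le_trans (_ : l / 12 * ((48 * 96) * L) <= _); last first.
    by rewrite ler_wpM2l// divr_ge0// ltW.
  have -> : l / 12 * ((48 * 96) * L) = (384 * l) * L by field.
  rewrite ler_wpM2r//.
  have : d ^+ 2 <= 1 by rewrite expr_le1// ltW.
  lra.
exists (S ++ T); split.
  by apply: le_trans T1; rewrite -natr1 mulrDl mul1r lerD2r.
by apply: le_trans T2; rewrite size_cat natrD mulrDr lerD2r.
Qed.

Lemma min_abs_le x : min_abs f <= `|f x|.
Proof. by rewrite /min_abs (bigD1 x)//= ge_min lexx. Qed.

End MainArgument.

(* A priori [d ^+ 3 >= C * ln L / L] with [L = ln p] leaves room for a Dirichlet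
   grid of [M] cells per frequency at every step of [mass_iteration]. *)
Lemma grid_room (R : realType) (p : nat) (c C d : R) :
  let K : R := ln (193 * 256) in let L : R := ln p%:R in
  (0 < p)%N -> 0 < c -> c <= ln L -> 1 <= L ->
  128 * (5 * K / c + 9) + 1 + c^-1 <= C ->
  0 < d <= 1 -> C * ln L <= d ^+ 3 * L ->
  forall j n : nat, j%:R * d <= 4 -> n%:R * d ^+ 2 <= 128 ->
  exists2 M : nat,
    (192 * 256) * ((48 * 96) * L / d ^+ 3) ^+ j / d ^+ 3 <= M%:R &
    (M ^ n < p)%N.
Proof.
move=> K L p0 c0 cL L1 CC /andP[d0 d1] hd j n jd nd.
have L0 : 0 < L by apply: lt_le_trans L1.
have lnL0 : 0 < ln L by apply: lt_le_trans cL.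
have K0 : 0 <= K by rewrite ln_ge0//; lra.
have d30 : 0 < d ^+ 3 by rewrite exprn_gt0.
have d31 : d ^+ 3 <= 1 by rewrite expr_le1// ltW.
set Q := (48 * 96) * L / d ^+ 3.
have Q1 : 1 <= Q by rewrite /Q ler_pdivlMr// mul1r; lra.
have Q0 : 0 < Q by apply: lt_le_trans Q1.
have Kc0 : 0 <= 5 * K / c by rewrite divr_ge0 ?mulr_ge0// ltW.
(* The summand [c^-1] of the lower bound for [C] serves here: [C * ln L >= c^-1 * c = 1]. *)
have d3L : 1 <= d ^+ 3 * L.
  apply: le_trans hd; apply: le_trans (_ : c^-1 * c <= _).
    by rewrite mulVf ?gt_eqF.
  rewrite ler_pM ?invr_ge0 ?(ltW c0)//.
  by apply: le_trans CC; lra.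
have lnd : - ln (d ^+ 3) <= ln L.
  rewrite -lnV ?posrE// ler_ln ?posrE ?invr_gt0//.
  by rewrite -[_^-1]mul1r ler_pdivrMr// mulrC.
have lnQ : ln Q <= K + 2 * ln L.
  rewrite ln_div ?posrE ?mulr_gt0// lnM ?posrE ?mulr_gt0//.
  have : ln (48 * 96) <= K by rewrite ler_ln ?posrE; lra.
  lra.
set X := (192 * 256) * Q ^+ j / d ^+ 3.
have Y1 : 1 <= Q ^+ j / d ^+ 3.
  by rewrite ler_pdivlMr// mul1r (le_trans d31)// exprn_ege1.
have X0 : 0 <= X by rewrite /X -mulrA mulr_ge0// (le_trans _ Y1).
have /andP[MX XM] := truncn_itv X0.
set M := (Num.trunc X).+1 in XM; exists M; first exact: ltW.
have M0 : (0 : R) < M%:R by rewrite ltr0n.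
have lnM : ln M%:R <= K + ln L + j%:R * (K + 2 * ln L).
  (* Rounding up adds at most 1, absorbed by passing from 192 to 193 since [Q ^ j / d ^ 3 >= 1]. *)
  have MY : M%:R <= (193 * 256) * (Q ^+ j / d ^+ 3).
    rewrite /M -natr1; apply: le_trans (lerD MX Y1) _.
    rewrite /X -mulrA; lra.
  apply: le_trans (_ : ln ((193 * 256) * (Q ^+ j / d ^+ 3)) <= _).
    by rewrite ler_ln ?posrE// (lt_le_trans M0).
  rewrite lnM ?posrE ?divr_gt0 ?exprn_gt0// -/K.
  rewrite ln_div ?posrE ?exprn_gt0// lnXn// -[_ *+ j]mulr_natl.
  have : j%:R * ln Q <= j%:R * (K + 2 * ln L) by rewrite ler_wpM2l.
  lra.
rewrite -(ltr_nat R) natrX -ltr_ln ?posrE ?exprn_gt0 ?ltr0n//.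
rewrite lnXn// -[_ *+ n]mulr_natl -/L.
(* From [d <= 1] and [j * d <= 4]: [(K + ln L) + 4 * (K + 2 * ln L) = 5 * K + 9 * ln L]. *)
have lnMd : ln M%:R * d <= 5 * K + 9 * ln L.
  apply: le_trans (ler_wpM2r (ltW d0) lnM) _.
  have : j%:R * d * (K + 2 * ln L) <= 4 * (K + 2 * ln L).
    by rewrite ler_wpM2r//; lra.
  have : (K + ln L) * d <= K + ln L by rewrite ler_piMr//; lra.
  lra.
have lnM0 : 0 <= ln (M%:R : R) by rewrite ln_ge0// ler1n.
have KL : 5 * K <= 5 * K / c * ln L.
  by rewrite mulrAC ler_pdivlMr// ler_wpM2l// mulr_ge0.
have : n%:R * ln M%:R * d ^+ 3 < L * d ^+ 3; last by rewrite ltr_pM2r.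
have -> : n%:R * ln M%:R * d ^+ 3 = (n%:R * d ^+ 2) * (ln M%:R * d) by ring.
apply: le_lt_trans (_ : 128 * (5 * K + 9 * ln L) < _).
  by rewrite ler_pM ?mulr_ge0 ?exprn_ge0// ltW.
rewrite [L * _]mulrC; apply: lt_le_trans hd.
(* [c <= ln L] turns the constant [5 * K] into a multiple of [ln L]; the extra [+ 1] makes the
   inequality strict. *)
apply: lt_le_trans (_ : (128 * (5 * K / c + 9) + 1) * ln L <= _).
  lra.
rewrite ler_wpM2r ?(ltW lnL0)//; apply: le_trans CC.
by rewrite lerDl invr_ge0 ltW.
Qed.

Theorem theorem1p3 (R : realType) :
  exists C : R, 0 < C /\
    forall p : nat, prime p -> (3 <= p)%N ->
    forall f : 'F_p -> R, mean f = 0 -> fourier_l1 f <= 1 ->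
    min_abs f <= C * (ln (ln p%:R) / ln p%:R) `^ 3^-1.
Proof.
(* The smallest value of [ln (ln p)] for [p >= 3]. *)
set c : R := ln (ln 3); set K : R := ln (193 * 256).
have ln3 := ln3_gt1 R.
have c0 : 0 < c by rewrite ln_gt0.
have K0 : 0 <= K by rewrite ln_ge0//; lra.
set C : R := 128 * (5 * K / c + 9) + 1 + c^-1.
have C1 : 1 <= C.
  have : 0 <= 5 * K / c by rewrite divr_ge0 ?mulr_ge0// ltW.
  have : 0 <= c^-1 by rewrite invr_ge0 ltW.
  rewrite /C; lra.
have C0 : 0 < C by apply: lt_le_trans C1.
exists C; split=> // p p_prime p_ge3 f f_mean f_l1.
set L : R := ln p%:R; rewrite leNgt; apply/negP; set d := min_abs f => hd.
have L3 : ln 3 <= L by rewrite ler_ln ?posrE ?ltr0n ?prime_gt0// ler_nat.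
have L1 : 1 <= L by apply: le_trans L3; exact: ltW.
have L0 : 0 < L by apply: lt_le_trans L1.
have cL : c <= ln L by rewrite ler_ln ?posrE// (lt_trans ltr01).
have lnL0 : 0 < ln L by apply: lt_le_trans cL.
have pow0 : 0 < (ln L / L) `^ 3^-1 by rewrite powR_gt0// divr_gt0.
have d0 : 0 < d by apply: lt_trans hd; rewrite mulr_gt0.
have d1 : d <= 1.
  by apply: le_trans (min_abs_le f 0) _; exact: norm_le1.
have d3 : C * ln L <= d ^+ 3 * L.
  have : C * (ln L / L) <= d ^+ 3; last first.
    by rewrite mulrA ler_pdivrMr.
  (* Cubing the assumed lower bound on [d] gives [C ^ 3], and [C <= C ^ 3] since [C >= 1]. *)
  apply: le_trans (_ : (C * (ln L / L) `^ 3^-1) ^+ 3 <= _); last first.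
    by rewrite lerXn2r ?nnegrE ?ltW// mulr_gt0.
  rewrite exprMn -(powR_mulrn 3 (powR_ge0 _ _)) -powRrM mulVf ?pnatr_eq0//.
  have lnL_L : 0 <= ln L / L by rewrite divr_ge0// ltW.
  rewrite powRr1// ler_wpM2r//.
  by rewrite ler_eXnr.
have d30 : 0 < d ^+ 3 by rewrite exprn_gt0.
have Q1 : 1 <= (48 * 96) * L / d ^+ 3.
  have : d ^+ 3 <= 1 by rewrite expr_le1// ltW.
  by rewrite ler_pdivlMr// mul1r; lra.
have d01 : 0 < d <= 1 by rewrite d0.
have iter := mass_iteration p_prime p_ge3 f_mean f_l1 d01 Q1 (min_abs_le f)
   (lexx _) (grid_room (prime_gt0 p_prime) c0 cL L1 (lexx C) d01 d3).
have d4 : 0 <= 4 / d by rewrite divr_ge0// ltW.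
have /andP[_ big] := truncn_itv d4.
(* After more than [4 / d] steps the explained mass would exceed 1. *)
have [S [massS _]] := iter (Num.trunc (4 / d)).+1.
have := le_trans massS (mass_le1 f_l1 _).
rewrite leNgt => /negP; apply.
by move: big; rewrite ltr_pdivrMr//; lra.
Qed.
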